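(* Let $T\in M^{m\times n}(\mathbb{C})$ and let $T=U-V$ be a proper splitting of $T$. Then the following assertions are equivalent: (a) $T^\dagger V\in M^n_+(\mathbb{C})$; (b) $TV^*\in M^m_+(\mathbb{C})$ and $r(TV^* )=r(V)$; (c) $0\leq U^\dagger V\leq P_{V^*}$; (d) $U^\dagger V\in M^n_+(\mathbb{C})$ and $\rho(U^\dagger V)=\dfrac{\rho(T^\dagger V)}{1+\rho(T^\dagger V)}<1$.
   Context: $M^{m\times n}(\mathbb{C})$ denotes the complex $m\times n$ matrices; $M^n_+(\mathbb{C})$ is the set of positive semidefinite $n\times n$ complex matrices (i.e. $\langle Ax,x\rangle\ge0$ for all $x\in\mathbb{C}^n$); $\leq$ is the Löwner order: for Hermitian $A,B$, $A\le B$ iff $B-A\in M^n_+(\mathbb{C})$. $A^\dagger$ is the Moore-Penrose inverse, $\mathcal{R}(\cdot)$, $\mathcal{N}(\cdot)$, $r(\cdot)$, $\rho(\cdot)$ denote range, nullspace, rank and spectral radius, and $P_{V^*}$ is the orthogonal projection onto $\mathcal{R}(V^* )$. Proper splitting: a decomposition $T=U-V$ with $U,V\in M^{m\times n}(\mathbb{C})$ is a proper splitting of $T\in M^{m\times n}(\mathbb{C})$ if $\mathcal{R}(U)=\mathcal{R}(T)$ and $\mathcal{N}(U)=\mathcal{N}(T)$. *)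

(* Defs.v *)
From mathcomp Require Import all_boot all_order all_algebra.
From mathcomp Require Import sesquilinear spectral complex.
From mathcomp Require Import boolp classical_sets reals.

Set Implicit Arguments.
Unset Strict Implicit.
Unset Printing Implicit Defensive.

Import Order.TTheory GRing.Theory Num.Theory.

Local Open Scope classical_set_scope.
Local Open Scope ring_scope.
Local Open Scope sesquilinear_scope.

Section ComplexMatrices.
Variable C : numClosedFieldType.

(* Matrices act on column vectors, [x |-> A *m x], whereas the row-space
   operations of mxalgebra describe [u |-> u *m A]. *)
Definition mxrange m n (A : 'M[C]_(m, n)) : set 'cV[C]_m :=
  range (fun x : 'cV[C]_n => A *m x).

Definition mxnull m n (A : 'M[C]_(m, n)) : set 'cV[C]_n :=
  [set x | A *m x = 0].

Definition cvdot n (x y : 'cV[C]_n) : C := (y^t* *m x) 0 0.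

(* In a numClosedFieldType, [0 <= z] means that z is real and nonnegative. *)
Definition psdmx n (A : 'M[C]_n) : Prop :=
  forall x : 'cV[C]_n, 0 <= cvdot (A *m x) x.

Definition loewner_le n (A B : 'M[C]_n) : Prop :=
  [/\ A \is hermsymmx, B \is hermsymmx & psdmx (B - A)].

Definition penrose m n (A : 'M[C]_(m, n)) (X : 'M[C]_(n, m)) : Prop :=
  [/\ A *m X *m A = A, X *m A *m X = X,
      (A *m X)^t* = A *m X & (X *m A)^t* = X *m A].

(* The default 0 is never used: see mpinvP. *)
Definition mpinv m n (A : 'M[C]_(m, n)) : 'M[C]_(n, m) :=
  xget 0 [set X | penrose A X].

Definition is_orthproj n (S : set 'cV[C]_n) (P : 'M[C]_n) : Prop :=
  [/\ P \is hermsymmx, P *m P = P & mxrange P = S].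

(* Meaningful when S is a linear subspace, in particular a range: see
   orthproj_rangeP. *)
Definition orthproj n (S : set 'cV[C]_n) : 'M[C]_n :=
  xget 0 [set P | is_orthproj S P].

Definition proper_splitting m n (T U V : 'M[C]_(m, n)) : Prop :=
  [/\ T = U - V, mxrange U = mxrange T & mxnull U = mxnull T].

Lemma hermsymmxP n (A : 'M[C]_n) : reflect (A^t* = A) (A \is hermsymmx).
Proof.
by rewrite qualifE/= expr0 scale1r; apply: (iffP eqP) => /esym.
Qed.

Lemma trmxC_mul m n p (A : 'M[C]_(m, n)) (B : 'M[C]_(n, p)) :
  (A *m B)^t* = B^t* *m A^t*.
Proof. by rewrite trmx_mul map_mxM. Qed.

Lemma mul_trmxC_eq0 m n (A : 'M[C]_(m, n)) : A *m A^t* = 0 -> A = 0.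
Proof.
move=> AA0; apply/row_matrixP => i; rewrite row0; apply/eqP.
apply: contraT => /dotmx_is_dotmx; rewrite dotmxE.
have -> : row i A *m (row i A)^t* = mxsub (fun=> i) (fun=> i) (A *m A^t*).
  by apply/matrixP => j k; rewrite !mxE; apply: eq_bigr => l _; rewrite !mxE.
by rewrite AA0 !mxE ltxx.
Qed.

Lemma gram_unit m n (A : 'M[C]_(m, n)) :
  row_free A -> A *m A^t* \in unitmx.
Proof.
move=> Afree; rewrite -row_free_unit -kermx_eq0; apply/eqP.
apply/(row_free_inj Afree); rewrite mul0mx; apply: mul_trmxC_eq0.
by rewrite trmxC_mul -mulmxA (mulmxA A) (mulmxA (kermx _)) mulmx_ker mul0mx.
Qed.

Lemma penrose_exists m n (A : 'M[C]_(m, n)) : exists X, penrose A X.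
Proof.
have [r [F [G [Ffull Gfree ->]]]] : exists r (F : 'M[C]_(m, r)) (G : 'M_(r, n)),
    [/\ row_full F, row_free G & A = F *m G].
  exists (\rank A), (col_base A), (row_base A).
  by rewrite col_base_full row_base_free mulmx_base.
set K := G *m G^t*; set H := F^t* *m F.
have Ku : K \in unitmx by exact: gram_unit.
have Hu : H \in unitmx.
  rewrite /H -{2}[F]trmxCK; apply: gram_unit.
  rewrite row_free_map -row_leq_rank ?mxrank_tr.
  by rewrite (eqP Ffull).
have Kh : K^t* = K by rewrite /K trmxC_mul trmxCK.
have Hh : H^t* = H by rewrite /H trmxC_mul trmxCK.
have Ki : (invmx K)^t* = invmx K by rewrite trmx_inv map_invmx Kh.
have Hi : (invmx H)^t* = invmx H by rewrite trmx_inv map_invmx Hh.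
pose X := G^t* *m invmx K *m invmx H *m F^t*.
have AX : F *m G *m X = F *m invmx H *m F^t*.
  by rewrite /X !mulmxA -(mulmxA F) -/K mulmxK.
have XA : X *m (F *m G) = G^t* *m invmx K *m G.
  by rewrite /X !mulmxA -(mulmxA _ (F^t*)) -/H mulmxKV.
exists X; split.
- by rewrite AX !mulmxA -(mulmxA _ (F^t*)) -/H mulmxKV.
- by rewrite XA {1}/X !mulmxA -(mulmxA _ G) -/K mulmxKV.
- by rewrite AX !trmxC_mul trmxCK Hi mulmxA.
- by rewrite XA !trmxC_mul trmxCK Ki mulmxA.
Qed.

Lemma penrose_uniq m n (A : 'M[C]_(m, n)) X Y :
  penrose A X -> penrose A Y -> X = Y.
Proof.
move=> [AXA XAX AXh XAh] [AYA YAY AYh YAh].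
have eqA : A *m X = A *m Y.
  by rewrite -{1}AYA -mulmxA -AYh -AXh -trmxC_mul mulmxA AXA.
have XY : X *m A *m (Y *m A) = X *m A.
  by rewrite mulmxA -mulmxA -mulmxA (mulmxA A) AYA.
have YX : Y *m A *m (X *m A) = Y *m A.
  by rewrite mulmxA -mulmxA -mulmxA (mulmxA A) AXA.
have eqB : X *m A = Y *m A.
  by rewrite -XY -{1}XAh -{1}YAh -trmxC_mul YX YAh.
by rewrite -XAX eqB -mulmxA eqA mulmxA YAY.
Qed.

Lemma mpinvP m n (A : 'M[C]_(m, n)) : penrose A (mpinv A).
Proof. exact: (xgetPex 0 (penrose_exists A)). Qed.

Lemma mpinv_uniq m n (A : 'M[C]_(m, n)) X : penrose A X -> mpinv A = X.
Proof. exact: penrose_uniq (mpinvP A). Qed.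

Lemma is_orthproj_uniq n (S : set 'cV[C]_n) P Q :
  is_orthproj S P -> is_orthproj S Q -> P = Q.
Proof.
have fixP P1 Q1 : P1 *m P1 = P1 -> mxrange Q1 = mxrange P1 -> P1 *m Q1 = Q1.
  move=> PP QP; apply/trmx_inj/row_matrixP => j; apply: trmx_inj.
  rewrite -!tr_col !trmxK !colE -mulmxA.
  have : mxrange P1 (Q1 *m delta_mx j 0) by rewrite -QP; exists (delta_mx j 0).
  by case=> x _ <-; rewrite mulmxA PP.
move=> [/hermsymmxP Ph PP PS] [/hermsymmxP Qh QQ QS].
have QPP : Q *m P = P by apply: fixP; rewrite // PS QS.
have PQQ : P *m Q = Q by apply: fixP; rewrite // PS QS.
by rewrite -Ph -QPP trmxC_mul Ph Qh PQQ.
Qed.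

Lemma orthproj_rangeP m n (A : 'M[C]_(m, n)) :
  is_orthproj (mxrange A) (orthproj (mxrange A)).
Proof.
apply: xgetPex; exists (A *m mpinv A).
have [AXA _ AXh _] := mpinvP A; split; first exact/hermsymmxP.
- by rewrite mulmxA AXA.
- apply/seteqP; split => _ [x _ <-].
    by exists (mpinv A *m x); rewrite ?mulmxA.
  by exists (A *m x); rewrite // mulmxA AXA.
Qed.

Lemma orthproj_range_uniq m n (A : 'M[C]_(m, n)) P :
  is_orthproj (mxrange A) P -> orthproj (mxrange A) = P.
Proof. exact: is_orthproj_uniq (orthproj_rangeP A). Qed.

End ComplexMatrices.

(* For n = 0 there is no eigenvalue and the value is sup set0 = 0. *)
Definition spectral_radius (R : realType) n (A : 'M[R[i]]_n) : R :=
  sup [set Normc.normc a | a in [set a | eigenvalue A a]].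

(* Main.v *)
(** Let [A = T^+ V] and [B = U^+ V].  For a proper splitting, [U^+ T], [T^+ U]
    and the common projection [T^+ T = U^+ U] satisfy
    [(U^+ T) (T^+ U) = T^+ T], which unfolds to [(1 - B) (1 + A) = 1].  Hence
    [B = A (1 + A)^-1], the spectra of [A] and [B] are exchanged by the
    increasing map [a |-> a / (1 + a)], and positivity is transported by
    congruences: [B = W A W + (A W)^* (A W)] with [W = 1 - B], and
    [A = M (B - B^2) M] with [M = 1 + A], where
    [B - B^2 = B (1 - B) B + (1 - B) B (1 - B)].  The last step needs
    [1 - B >= 0], which follows from [B <= P_{V^*} <= 1], or from
    [rho(B) < 1] by the spectral theorem.  Finally [V^* = T^+ T V^*], so
    the rank condition always holds and [T V^*] is congruent to [A]. *)
Require Import Defs.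
From mathcomp Require Import all_boot all_order all_algebra.
From mathcomp Require Import sesquilinear spectral complex.
From mathcomp Require Import boolp classical_sets reals.

Import Order.TTheory GRing.Theory Num.Theory.

Local Open Scope ring_scope.
Local Open Scope sesquilinear_scope.

Set Implicit Arguments.
Unset Strict Implicit.
Unset Printing Implicit Defensive.

Section Matrices.
Variable C : numClosedFieldType.

(** * Adjoints, and inclusions of ranges and nullspaces *)

Lemma trmxC_add m n (A B : 'M[C]_(m, n)) : (A + B)^t* = A^t* + B^t*.
Proof. by rewrite linearD map_mxD. Qed.

Lemma trmxC_sub m n (A B : 'M[C]_(m, n)) : (A - B)^t* = A^t* - B^t*.
Proof. by rewrite linearB map_mxB. Qed.

Lemma trmxC_scale m n a (A : 'M[C]_(m, n)) : (a *: A)^t* = a^* *: A^t*.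
Proof. by rewrite linearZ /= map_mxZ. Qed.

Lemma trmxC_1 n : (1%:M : 'M[C]_n)^t* = 1%:M.
Proof. by rewrite trmx1 map_mx1. Qed.

Lemma trmxC_inj m n : injective (fun A : 'M[C]_(m, n) => A^t*).
Proof. by move=> A B /(congr1 (fun X => X^t*)); rewrite !trmxCK. Qed.

(** The adjoint of a left inverse of [M] is a right inverse, hence the same matrix. *)
Lemma trmxC_inverse n (M W : 'M[C]_n) :
  M^t* = M -> W *m M = 1%:M -> W^t* = W.
Proof.
move=> Mh WM; have MW' : M *m W^t* = 1%:M.
  by rewrite -{1}Mh -trmxC_mul WM trmxC_1.
by rewrite -[LHS]mul1mx -WM -mulmxA MW' mulmx1.
Qed.

Lemma mulmx_cV_inj m n (A B : 'M[C]_(m, n)) :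
  (forall x : 'cV_n, A *m x = B *m x) -> A = B.
Proof.
by move=> AB; apply/trmx_inj/row_matrixP => j; rewrite -!tr_col !colE AB.
Qed.

Lemma mxrange_sub_mpinv m n p (A : 'M[C]_(m, n)) (B : 'M[C]_(m, p)) :
  (mxrange A `<=` mxrange B)%classic -> B *m mpinv B *m A = A.
Proof.
move=> AB; apply: mulmx_cV_inj => x; rewrite -mulmxA.
have [y _ <-] : mxrange B (A *m x) by apply: AB; exists x.
by have [BXB _ _ _] := mpinvP B; rewrite mulmxA BXB.
Qed.

(** The columns of [1 - mpinv B *m B] lie in the nullspace of [B], hence in that of [A]. *)
Lemma mxnull_sub_mpinv m n p (A : 'M[C]_(m, n)) (B : 'M[C]_(p, n)) :
  (mxnull B `<=` mxnull A)%classic -> A *m (mpinv B *m B) = A.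
Proof.
move=> BA; have [BXB _ _ _] := mpinvP B.
apply: mulmx_cV_inj => x; apply/esym/eqP.
rewrite -subr_eq0 -mulmxBl -{1}[A]mulmx1 -mulmxBr -mulmxA; apply/eqP/BA.
by rewrite /mxnull /= mulmxA mulmxBr mulmx1 mulmxA BXB subrr mul0mx.
Qed.

(** * Positive semidefinite matrices *)

Lemma psdmxP n (A : 'M[C]_n) :
  psdmx A <-> forall x : 'cV_n, 0 <= (x^t* *m A *m x) 0 0.
Proof. by split=> Apsd x; have := Apsd x; rewrite /cvdot mulmxA. Qed.

Lemma psdmx_add n (A B : 'M[C]_n) : psdmx A -> psdmx B -> psdmx (A + B).
Proof.
move=> /psdmxP pA /psdmxP pB; apply/psdmxP => x.
by rewrite mulmxDr mulmxDl mxE addr_ge0.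
Qed.

Lemma psdmx_congr m n (A : 'M[C]_m) (S : 'M[C]_(m, n)) :
  psdmx A -> psdmx (S^t* *m A *m S).
Proof.
move=> /psdmxP pA; apply/psdmxP => x.
by have := pA (S *m x); rewrite trmxC_mul !mulmxA.
Qed.

Lemma psdmx_1 n : psdmx (1%:M : 'M[C]_n).
Proof.
apply/psdmxP => x; rewrite mulmx1 mxE sumr_ge0 // => i _.
by rewrite !mxE mulrC mul_conjC_ge0.
Qed.

Lemma psdmx_gram m n (S : 'M[C]_(m, n)) : psdmx (S^t* *m S).
Proof. by rewrite -[S^t*]mulmx1; apply/psdmx_congr/psdmx_1. Qed.

(* Polarization, comparing the pairs [(x, y)] and [(x, 'i *: y)]. *)
Lemma cquad_eq0 n (K : 'M[C]_n) :
  (forall x : 'cV_n, x^t* *m K *m x = 0) -> K = 0.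
Proof.
move=> K0; have pol (x y : 'cV_n) : x^t* *m K *m y + y^t* *m K *m x = 0.
  have := K0 (x + y); rewrite trmxC_add !mulmxDl !mulmxDr !K0 add0r addr0.
  by rewrite addrC.
have K0' (x y : 'cV_n) : x^t* *m K *m y = 0.
  have := pol x ('i *: y); rewrite trmxC_scale -!scalemxAl -scalemxAr /=.
  rewrite conjCi scaleNr => /subr0_eq /(scalerI (neq0Ci C)) eqxy.
  have /eqP := pol x y; rewrite -eqxy -mulr2n -scaler_nat scaler_eq0.
  by rewrite pnatr_eq0 /= => /eqP.
(* The choice [x = K *m y] shows that [K *m y] has norm zero. *)
apply: mulmx_cV_inj => y; rewrite mul0mx; apply: trmxC_inj.
rewrite /= linear0 map_mx0; apply: mul_trmxC_eq0; rewrite trmxCK.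
by rewrite mulmxA K0'.
Qed.

(** The order on [C] makes the quadratic form real, so [A] and its adjoint share it, and
    polarization equates them. *)
Lemma psdmx_herm n (A : 'M[C]_n) : psdmx A -> A^t* = A.
Proof.
move=> /psdmxP pA; apply/eqP; rewrite eq_sym -subr_eq0.
apply/eqP/cquad_eq0 => x.
rewrite mulmxBr mulmxBl; apply/eqP; rewrite subr_eq0; apply/eqP.
have -> : x^t* *m A^t* *m x = (x^t* *m A *m x)^t*.
  by rewrite !trmxC_mul trmxCK mulmxA.
by apply/matrixP => i j; rewrite !ord1 [RHS]mxE [X in _ = _ X]mxE geC0_conj.
Qed.

Lemma psdmx_trmxC n (A : 'M[C]_n) : psdmx (A^t*) -> psdmx A.
Proof. by move=> pA; rewrite -[A]trmxCK (psdmx_herm pA). Qed.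

(** * Eigenvalues and the spectral theorem *)

Lemma psdmx_eigenvalue_ge0 n (A : 'M[C]_n) a :
  psdmx A -> eigenvalue A a -> 0 <= a.
Proof.
(* Eigenvectors are rows here, so the test vector is the adjoint of [v]. *)
move=> /psdmxP pA /eigenvalueP[v vA v0]; have := pA (v^t*).
rewrite trmxCK vA -scalemxAl mxE pmulr_lge0 // -dotmxE.
exact: dotmx_is_dotmx.
Qed.

Lemma eigenvalue_spectral_diag n (A : 'M[C]_n) i :
  A \is normalmx -> eigenvalue A (spectral_diag A 0 i).
Proof.
move=> /orthomx_spectralP eqA; set P := spectralmx A in eqA.
have Pu : P \in unitmx by rewrite unitarymx_unit ?spectral_unitarymx.
apply/eigenvalueP; exists (row i P); last first.
  (* A zero row would contradict the invertibility of [P]. *)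
  apply: contraTneq (Pu) => Pi0; rewrite -row_free_unit.
  apply/negP => /row_freeP[Q /(congr1 (row i))].
  rewrite row_mul Pi0 mul0mx => /rowP/(_ i); rewrite !mxE eqxx.
  by move/eqP; rewrite eq_sym oner_eq0.
rewrite -row_mul {1}eqA !mulmxA mulmxV // mul1mx row_mul row_diag_mx.
by rewrite -scalemxAl -rowE.
Qed.

Lemma psdmx_diag n (d : 'rV[C]_n) :
  (forall i, 0 <= d 0 i) -> psdmx (diag_mx d).
Proof.
move=> d0; apply/psdmxP => x; rewrite mxE sumr_ge0 // => i _.
by rewrite mul_mx_diag !mxE mulrAC mulr_ge0 // mulrC mul_conjC_ge0.
Qed.

(** Unitary diagonalization of [B] makes [1 - B] congruent to a diagonal matrix with entries
    [1 - b]. *)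
Lemma psdmx_1B n (B : 'M[C]_n) :
  B \is hermsymmx -> (forall b, eigenvalue B b -> b <= 1) ->
  psdmx (1%:M - B).
Proof.
move=> /hermitian_normalmx Bn B1; have /orthomx_spectralP eqB := Bn.
have Pu := spectral_unitarymx B; set P := spectralmx B in eqB Pu.
rewrite {1}eqB -[1%:M](mulVmx (unitarymx_unit Pu)).
rewrite -{1}[invmx P]mulmx1 -mulmxBl -mulmxBr invmx_unitary //.
apply: psdmx_congr; rewrite -diag_const_mx -linearB; apply: psdmx_diag => i.
by rewrite !mxE subr_ge0 B1 ?eigenvalue_spectral_diag.
Qed.

(** * Consequences of [(1 - B) (1 + A) = 1] *)

Section Resolvent.
Variables (n : nat) (A B : 'M[C]_n).
Hypothesis BA1 : (1%:M - B) *m (1%:M + A) = 1%:M.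

Let AB1 : (1%:M + A) *m (1%:M - B) = 1%:M. Proof. exact: mulmx1C. Qed.

Lemma resolvent_mull : (1%:M - B) *m A = B.
Proof.
have := BA1; rewrite mulmxDr mulmx1 => /(canRL (addKr _)) ->.
by rewrite opprB subrK.
Qed.

Lemma resolvent_mulr : A *m (1%:M - B) = B.
Proof.
have := AB1; rewrite mulmxDl mul1mx => /(canRL (addKr _)) ->.
by rewrite opprB subrK.
Qed.

Lemma resolvent_psd : psdmx A -> psdmx B /\ psdmx (1%:M - B).
Proof.
move=> pA; have Mh : (1%:M + A)^t* = 1%:M + A.
  by rewrite trmxC_add trmxC_1 (psdmx_herm pA).
have Wh := trmxC_inverse Mh BA1; set W := 1%:M - B in Wh *.
split.
  (* Both [W A] and [A W] equal [B], so the right side is [B W + B B]. *)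
  have -> : B = W^t* *m A *m W + (A *m W)^t* *m (A *m W).
    rewrite trmxC_mul Wh (psdmx_herm pA) resolvent_mull resolvent_mulr.
    by rewrite -mulmxDr subrK mulmx1.
  exact: psdmx_add (psdmx_congr _ pA) (psdmx_gram _).
have -> : W = W^t* *m (1%:M + A) *m W by rewrite Wh BA1 mul1mx.
exact/psdmx_congr/psdmx_add/pA/psdmx_1.
Qed.

Lemma psd_of_resolvent : psdmx B -> psdmx (1%:M - B) -> psdmx A.
Proof.
move=> pB pW; have Wh := psdmx_herm pW.
have Mh := trmxC_inverse Wh AB1; set M := 1%:M + A in Mh *.
have pBW : psdmx (B *m (1%:M - B)).
  have -> : B *m (1%:M - B) = B^t* *m (1%:M - B) *m B
                            + (1%:M - B)^t* *m B *m (1%:M - B).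
    rewrite Wh (psdmx_herm pB).
    have -> : (1%:M - B) *m B = B *m (1%:M - B).
      by rewrite mulmxBl mulmxBr mul1mx mulmx1.
    by rewrite -mulmxDr [B + _]addrC subrK mulmx1.
  exact/psdmx_add/psdmx_congr/pB/psdmx_congr.
(* Cancelling [(1 - B) M = 1] leaves [M A (1 - B)], and [M] commutes with [A]. *)
have -> : A = M^t* *m (B *m (1%:M - B)) *m M.
  rewrite Mh -!mulmxA BA1 mulmx1 -resolvent_mulr mulmxA.
  have -> : M *m A = A *m M by rewrite mulmxDl mulmxDr mul1mx mulmx1.
  by rewrite -mulmxA AB1 mulmx1.
exact: psdmx_congr.
Qed.

(** A left eigenvector of [A] is also one of [B]: apply it to [A (1 - B) = B]. *)
Lemma eigenvalue_resolvent a :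
  1 + a != 0 -> eigenvalue A a -> eigenvalue B (a / (1 + a)).
Proof.
move=> a1 /eigenvalueP[v vA v0]; apply/eigenvalueP; exists v => //.
apply: (scalerI a1); rewrite scalerA mulrCA divff // mulr1 scalerDl scale1r.
have vB : v *m B = a *: v - a *: (v *m B).
  by rewrite -{1}resolvent_mulr mulmxA vA -scalemxAl mulmxBr mulmx1 scalerBr.
by rewrite {1}vB subrK.
Qed.

Lemma eigenvalue_of_resolvent b :
  1 - b != 0 -> eigenvalue B b -> eigenvalue A (b / (1 - b)).
Proof.
move=> b1 /eigenvalueP[v vB v0]; apply/eigenvalueP; exists v => //.
apply: (scalerI b1); rewrite scalerA mulrCA divff // mulr1.
by rewrite -vB -resolvent_mull mulmxA mulmxBr mulmx1 vB -{2}[v]scale1r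
  -scalerBl -scalemxAl.
Qed.

(** An eigenvector for the value 1 would be killed by the invertible [1 - B]. *)
Lemma eigenvalue_resolvent_neq1 b : eigenvalue B b -> 1 - b != 0.
Proof.
move=> /eigenvalueP[v vB v0]; apply: contra v0; rewrite subr_eq0 => /eqP b1.
by rewrite -[v]mulmx1 -BA1 mulmxA mulmxBr mulmx1 vB -b1 scale1r subrr mul0mx.
Qed.

End Resolvent.

(** The projection fixes every column of [V^t*]; the claim is the adjoint of this. *)
Lemma mulmx_orthproj m n (V : 'M[C]_(m, n)) :
  V *m orthproj (mxrange (V^t*)) = V.
Proof.
have [/hermsymmxP Eh EE rE] := orthproj_rangeP (V^t*).
apply: trmxC_inj; rewrite /= trmxC_mul Eh; apply: mulmx_cV_inj => x.
rewrite -mulmxA; set y := V^t* *m x.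
have [z _ <-] : mxrange (orthproj (mxrange (V^t*))) y by rewrite rE; exists x.
by rewrite mulmxA EE.
Qed.

(** * Proper splittings *)

Section ProperSplitting.
Variables (m n : nat) (T U V : 'M[C]_(m, n)).
Hypothesis splitTUV : proper_splitting T U V.

Local Notation A := (mpinv T *m V).
Local Notation B := (mpinv U *m V).
Local Notation E := (orthproj (mxrange (V^t*))).

Let rangeT : T *m mpinv T *m U = U.
Proof. by case: splitTUV => _ rU _; apply: mxrange_sub_mpinv; rewrite rU. Qed.

Let nullT : U *m (mpinv T *m T) = U.
Proof. by case: splitTUV => _ _ nU; apply: mxnull_sub_mpinv; rewrite nU. Qed.

Let nullU : T *m (mpinv U *m U) = T.
Proof. by case: splitTUV => _ _ nU; apply: mxnull_sub_mpinv; rewrite nU. Qed.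

Let VE : V = U - T.
Proof. by case: splitTUV => -> _ _; rewrite opprB addrC subrK. Qed.

(** Each projection absorbs the other because the nullspaces agree; Hermitian symmetry then equates
    them. *)
Let projTU : mpinv U *m U = mpinv T *m T.
Proof.
have [_ _ _ Uh] := mpinvP U; have [_ _ _ Th] := mpinvP T.
have PUT : mpinv U *m U *m (mpinv T *m T) = mpinv U *m U.
  by rewrite -mulmxA nullT.
by rewrite -Uh -PUT trmxC_mul Uh Th -mulmxA nullU.
Qed.

Lemma mulmx_mpinv_splitting : T *m A = V.
Proof.
have [TXT _ _ _] := mpinvP T.
by rewrite mulmxA VE mulmxBr rangeT TXT.
Qed.

Lemma mpinv_mulmx_splitting : V *m (mpinv T *m T) = V.
Proof.
have [TXT _ _ _] := mpinvP T.
by rewrite VE mulmxBl nullT mulmxA TXT.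
Qed.

Lemma proper_splitting_resolvent : (1%:M - B) *m (1%:M + A) = 1%:M.
Proof.
set P := mpinv T *m T; have [TXT XTX _ _] := mpinvP T.
have PP : P *m P = P by rewrite /P mulmxA XTX.
have PA : P *m A = A by rewrite /P mulmxA XTX.
have BP : B *m P = B by rewrite -mulmxA mpinv_mulmx_splitting.
have UT : mpinv U *m T = P - B.
  by rewrite /P -projTU -mulmxBr VE opprB addrC subrK.
have TU : mpinv T *m U = P + A by rewrite /P -mulmxDr VE addrC subrK.
have : (P - B) *m (P + A) = P.
  by rewrite -UT -TU !mulmxA -(mulmxA _ T) -(mulmxA _ _ U) rangeT projTU.
(* Since [P A = A] and [B P = B], expansion leaves [A = B + B A], which is the same relation with
   [1] in place of [P]. *)
rewrite !mulmxBl !mulmxDr PP PA BP !mul1mx !mulmx1.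
by rewrite -!addrA => /(canRL (addKr _)) ->; rewrite addNr addr0.
Qed.

Lemma mpinv_mulmx_trmxC : mpinv T *m (T *m V^t*) = V^t*.
Proof.
have [_ _ _ Th] := mpinvP T.
by rewrite mulmxA -Th -trmxC_mul mpinv_mulmx_splitting.
Qed.

(** [V^t*] and [T *m V^t*] arise from each other by left multiplication, so neither rank exceeds the
    other. *)
Lemma rank_mulmx_trmxC : \rank (T *m V^t*) = \rank V.
Proof.
have <- : \rank (V^t*) = \rank V by rewrite mxrank_map mxrank_tr.
apply/eqP; rewrite eqn_leq mxrankM_maxr -{1}mpinv_mulmx_trmxC.
exact: mxrankM_maxr.
Qed.

(** With [A] Hermitian, [T V^*] is [T A T^*]. The congruence back by [mpinv T] yields the adjoint of
    [A], whose symmetry is not known beforehand. *)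
Lemma psd_mulmx_trmxC : psdmx A <-> psdmx (T *m V^t*).
Proof.
split=> [pA|pTV].
  suff -> : T *m V^t* = (T^t*)^t* *m A *m T^t* by exact: psdmx_congr.
  rewrite trmxCK -{1}mulmx_mpinv_splitting trmxC_mul (psdmx_herm pA).
  by rewrite mulmxA.
apply: psdmx_trmxC.
have -> : A^t* = ((mpinv T)^t*)^t* *m (T *m V^t*) *m (mpinv T)^t*.
  by rewrite trmxCK mpinv_mulmx_trmxC trmxC_mul.
exact: psdmx_congr.
Qed.

Lemma psd_loewner :
  psdmx A <-> loewner_le 0 B /\ loewner_le B E.
Proof.
have [/hermsymmxP Eh EE _] := orthproj_rangeP (V^t*).
have BE : B *m E = B by rewrite -mulmxA mulmx_orthproj.
split=> [pA|[[_ _ pB] [_ _ pEB]]].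
  have [pB pW] := resolvent_psd proper_splitting_resolvent pA.
  have Bh := psdmx_herm pB; have EB : E *m B = B.
    by rewrite -{2}Bh -{2}BE trmxC_mul Bh Eh.
  split; split; try exact/hermsymmxP; last 1 first.
  (* [E] acts as the identity on both sides of [B], so [E - B] is a compression of [1 - B]. *)
  - suff -> : E - B = E^t* *m (1%:M - B) *m E by exact: psdmx_congr.
    by rewrite Eh mulmxBr mulmx1 mulmxBl EE EB BE.
  - by apply/hermsymmxP; rewrite linear0 map_mx0.
  - by rewrite subr0.
rewrite subr0 in pB.
apply: (psd_of_resolvent proper_splitting_resolvent pB).
(* The remaining gap [1 - E] is an orthogonal projection, hence a Gram matrix. *)
have -> : 1%:M - B = (E - B) + (1%:M - E)^t* *m (1%:M - E).
  rewrite trmxC_sub trmxC_1 Eh mulmxBl mul1mx mulmxBr mulmx1 EE subrr subr0.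
  by rewrite [RHS]addrC addrA subrK.
exact: psdmx_add pEB (psdmx_gram _).
Qed.

End ProperSplitting.
End Matrices.

(** * Spectral radii under the map [x / (1 + x)] *)

Section SpectralRadius.
Variable R : realType.

Lemma ge0_normcK (a : R[i]) : 0 <= a -> (Normc.normc a)%:C%C = a.
Proof. by move=> a0; rewrite -[RHS]ger0_norm. Qed.

Lemma normc_ge0 (a : R[i]) : 0 <= Normc.normc a.
Proof. by case: a => x y; exact: sqrtr_ge0. Qed.

Lemma normc_real (x : R) : 0 <= x -> Normc.normc x%:C%C = x.
Proof. by move=> x0; rewrite /= expr0n addr0 sqrtr_sqr ger0_norm. Qed.

(** The moduli of all roots of the characteristic polynomial sum to a crude bound, enough for [sup]
    to be a true supremum when the spectrum is nonempty. *)
Lemma eigenvalues_bounded n (A : 'M[R[i]]_n) :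
  has_ubound [set Normc.normc a | a in [set a | eigenvalue A a]]%classic.
Proof.
have [s ps] := closed_field_poly_normal (char_poly A).
exists (\sum_(z <- s) Normc.normc z) => _ [a /= Aa <-].
have : a \in s.
  move: Aa; rewrite eigenvalue_root_char ps (monicP (char_poly_monic A)).
  by rewrite scale1r root_prod_XsubC.
move=> sa; rewrite (big_rem a sa) lerDl sumr_ge0 // => z _; exact: normc_ge0.
Qed.

Lemma eigenvalue_le_spectral_radius n (A : 'M[R[i]]_n) a :
  eigenvalue A a -> Normc.normc a <= spectral_radius A.
Proof.
by move=> Aa; apply: ub_le_sup (eigenvalues_bounded A) _ _; exists a.
Qed.

(** The bound [0 <= x] handles the empty spectrum, where [sup] is 0. *)
Lemma spectral_radius_le n (A : 'M[R[i]]_n) x :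
  0 <= x -> (forall a, eigenvalue A a -> Normc.normc a <= x) ->
  spectral_radius A <= x.
Proof.
move=> x0 Ax; rewrite /spectral_radius.
have [->|/set0P S0] := eqVneq
  [set Normc.normc a | a in [set a | eigenvalue A a]]%classic set0.
  by rewrite sup0.
by apply: ge_sup => // _ [a /= Aa <-]; exact: Ax.
Qed.

Lemma spectral_radius_ge0 n (A : 'M[R[i]]_n) : 0 <= spectral_radius A.
Proof.
rewrite /spectral_radius; have [->|/set0P S0] := eqVneq
  [set Normc.normc a | a in [set a | eigenvalue A a]]%classic set0.
  by rewrite sup0.
have [_ [a Aa _]] := S0.
exact: le_trans (normc_ge0 a) (eigenvalue_le_spectral_radius Aa).
Qed.

Lemma ratio_lt1 (x : R) : 0 <= x -> x / (1 + x) < 1.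
Proof. by move=> x0; rewrite ltr_pdivrMr ?mul1r ?ltrDr ?ltr_pwDl. Qed.

(** The increasing maps [x / (1 + x)] and [r / (1 - r)] are mutually inverse; this carries bounds
    from one spectrum to the other. *)
Lemma ratio_le (x r : R) :
  0 <= x -> r < 1 -> (x / (1 + x) <= r) = (x <= r / (1 - r)).
Proof.
move=> x0 r1; rewrite ler_pdivrMr ?ltr_pwDl // ler_pdivlMr ?subr_gt0 //.
by rewrite mulrDr mulrBr !mulr1 lerBlDr [r * x]mulrC.
Qed.

Lemma ratio_inv (x : R) :
  0 <= x -> x / (1 + x) / (1 - x / (1 + x)) = x.
Proof.
move=> x0; have x1 : 1 + x != 0 by rewrite gt_eqF ?ltr_pwDl.
have -> : 1 - x / (1 + x) = (1 + x)^-1.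
  by rewrite -{1}(divff x1) -mulrBl addrK mul1r.
by rewrite invrK mulfVK.
Qed.

Lemma normc_ratio (a : R[i]) :
  0 <= a -> Normc.normc (a / (1 + a)) = Normc.normc a / (1 + Normc.normc a).
Proof.
move=> a0; have n0 := normc_ge0 a; rewrite -{1 2}(ge0_normcK a0).
rewrite -(rmorph1 (real_complex R)) -rmorphD -fmorphV -rmorphM.
by rewrite normc_real // divr_ge0 // addr_ge0.
Qed.

Lemma spectral_radius_lt1_psd n (B : 'M[R[i]]_n) :
  psdmx B -> spectral_radius B < 1 -> psdmx (1%:M - B).
Proof.
move=> pB B1; apply: psdmx_1B => [|b Bb]; first exact/hermsymmxP/psdmx_herm.
rewrite -(ge0_normcK (psdmx_eigenvalue_ge0 pB Bb)) lecR ltW //.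
exact: le_lt_trans (eigenvalue_le_spectral_radius Bb) B1.
Qed.

(** Two opposite inequalities are checked eigenvalue by eigenvalue, so no eigenvalue attaining the
    supremum has to be produced. *)
Lemma spectral_radius_resolvent n (A B : 'M[R[i]]_n) :
  (1%:M - B) *m (1%:M + A) = 1%:M -> psdmx A ->
  spectral_radius B = spectral_radius A / (1 + spectral_radius A).
Proof.
move=> BA1 pA; have rA := spectral_radius_ge0 A.
have r1 := ratio_lt1 rA.
have le : spectral_radius B <= spectral_radius A / (1 + spectral_radius A).
  apply: spectral_radius_le => [|b Bb]; first by rewrite divr_ge0 ?addr_ge0.
  have b1 := eigenvalue_resolvent_neq1 BA1 Bb.
  have Aa := eigenvalue_of_resolvent BA1 b1 Bb; set a := b / (1 - b) in Aa.
  have a0 := psdmx_eigenvalue_ge0 pA Aa.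
  have -> : b = a / (1 + a).
    have -> : 1 + a = (1 - b)^-1.
      by rewrite /a -{1}(divff b1) -mulrDl subrK mul1r.
    by rewrite invrK mulfVK.
  rewrite normc_ratio // ratio_le ?normc_ge0 // ratio_inv //.
  exact: eigenvalue_le_spectral_radius.
(* The first inequality already gives [spectral_radius B < 1], which [ratio_le] requires in the
   second. *)
have rB := spectral_radius_ge0 B; have rB1 := le_lt_trans le r1.
apply/eqP; rewrite eq_le le /= ratio_le //.
apply: spectral_radius_le => [|a Aa].
  by rewrite divr_ge0 // subr_ge0 ltW.
have a0 := psdmx_eigenvalue_ge0 pA Aa.
rewrite -(ratio_le (normc_ge0 a) rB1) -(normc_ratio a0).
apply: eigenvalue_le_spectral_radius; apply: (eigenvalue_resolvent BA1) Aa.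
by rewrite gt_eqF // ltr_pwDl.
Qed.

End SpectralRadius.

Theorem proposition6p1 (R : realType) (m n : nat) (T U V : 'M[R[i]]_(m, n))
    (hT : proper_splitting T U V) :
  [<-> psdmx (mpinv T *m V);
       psdmx (T *m V^t*) /\ \rank (T *m V^t*) = \rank V;
       loewner_le 0 (mpinv U *m V) /\
         loewner_le (mpinv U *m V) (orthproj (mxrange (V^t*)));
       psdmx (mpinv U *m V) /\
         spectral_radius (mpinv U *m V) =
           spectral_radius (mpinv T *m V) /
             (1 + spectral_radius (mpinv T *m V)) /\
         spectral_radius (mpinv T *m V) /
             (1 + spectral_radius (mpinv T *m V)) < 1].
Proof.
have BA1 := proper_splitting_resolvent hT.
tfae.
- move=> pA; split; first exact/(psd_mulmx_trmxC hT).
  exact: (rank_mulmx_trmxC hT).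
- by move=> [/(psd_mulmx_trmxC hT) pA _]; apply/(psd_loewner hT).
- move=> /(psd_loewner hT) pA; split; first by case: (resolvent_psd BA1 pA).
  split; first exact: spectral_radius_resolvent.
  exact/ratio_lt1/spectral_radius_ge0.
(* The equality turns the bound on the ratio into [spectral_radius (mpinv U *m V) < 1]. *)
- move=> [pB [<- rB1]].
  exact: psd_of_resolvent BA1 pB (spectral_radius_lt1_psd pB rB1).
Qed.
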